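(* Let $C^* = \sum_{k=1}^{2^{d-1}} w_k C^{(k)}$ be an extremal mixture copula. The following statements are equivalent: (1) $C^*$ is exchangeable. (2) $C^*$ is equiconcordant. (3) For all $k,l\in\{1,\ldots,2^{d-1}\}$ the weights satisfy $w_k = w_l$ whenever $\eta_k=\eta_l$.
   Context: Let $d \ge 2$ and $\mathcal{D} = \{1,\ldots,d\}$. A $d$-dimensional copula is a distribution function on $[0,1]^d$ with standard uniform margins. $\mathcal{E}(\mathcal{D})$ is the collection of all subsets of $\mathcal{D}$ of even cardinality, including $\emptyset$. Extremal copulas: for $k\in\{1,\ldots,2^{d-1}\}$ let $\boldsymbol{s}_k\in\{0,1\}^d$ be the vector of digits of $k-1$ written as a $d$-digit binary number, let $J_k=\{j\in\mathcal{D}: s_{k,j}=0\}$ and $J_k^\complement = \mathcal{D}\setminus J_k$. The $k$th extremal copula is $C^{(k)}(\boldsymbol{u}) = (\min_{j\in J_k}u_j + \min_{j\in J_k^\complement}u_j - 1)^+$, with $\min_{j\in\emptyset}u_j = 1$ and $x^+=\max(x,0)$. An extremal mixture copula is a copula of the form $\sum_{k=1}^{2^{d-1}} w_k C^{(k)}$ with $w_k\ge 0$ and $\sum_k w_k = 1$. The comonotonic number of $C^{(k)}$ is $\eta_k = \max(|J_k|,|J_k^\complement|)$. A copula $C$ is exchangeable if $C(\Pi(\boldsymbol{u})) = C(\boldsymbol{u})$ for all $\boldsymbol{u}\in[0,1]^d$ and every permutation $\Pi$ of the coordinates. Concordance probabilities: let $\boldsymbol{U}\sim C$ and $\boldsymbol{U}^*$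 an independent copy. For $I\subseteq\mathcal{D}$, $\boldsymbol{U}_I$ is the subvector with indices in $I$. For $|I|\ge 2$, $\kappa_I = \mathbb{P}(\{\boldsymbol{U}_I \le \boldsymbol{U}_I^*\}\cup\{\boldsymbol{U}_I^*\le \boldsymbol{U}_I\})$ (componentwise inequalities); $\kappa_I = 1$ when $|I|\le 1$. A copula is equiconcordant if $\kappa_I=\kappa_{\tilde I}$ for all $I,\tilde I\in\mathcal{E}(\mathcal{D})$ with $|I|=|\tilde I|$. *)

(* Defs.v *)
From HB Require Import structures.
From mathcomp Require Import all_boot all_order all_algebra all_fingroup.
From mathcomp Require Import all_classical all_reals all_analysis.
Set Implicit Arguments.
Unset Strict Implicit.
Unset Printing Implicit Defensive.
Import Order.TTheory GRing.Theory Num.Theory.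
Local Open Scope classical_set_scope.
Local Open Scope ring_scope.

Definition unit_cube (R : realType) (d : nat) : set (d.-tuple R) :=
  [set u | forall j, 0 <= tnth u j <= 1].

(* [U] has joint distribution function [C] on the unit cube and standard uniform
   margins; values of [C] off the cube are irrelevant throughout. *)
Definition follows (R : realType) (d : nat) (disp : measure_display)
    (T : measurableType disp) (P : probability T R)
    (U : {RV P >-> d.-tuple R}) (C : d.-tuple R -> R) : Prop :=
  (forall j (A : set R), measurable A ->
     P [set t | A (tnth (U t) j)] = uniform_prob (@ltr01 R) A) /\
  (forall u, unit_cube u ->
     P [set t | forall j, tnth (U t) j <= tnth u j] = (C u)%:E).

Definition copula (R : realType) (d : nat) (C : d.-tuple R -> R) : Prop :=
  exists (disp : measure_display) (T : measurableType disp)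
         (P : probability T R) (U : {RV P >-> d.-tuple R}), follows U C.

Definition independent (R : realType) (d : nat) (disp : measure_display)
    (T : measurableType disp) (P : probability T R)
    (U V : {RV P >-> d.-tuple R}) : Prop :=
  forall A B : set (d.-tuple R), measurable A -> measurable B ->
    P (U @^-1` A `&` V @^-1` B) = (P (U @^-1` A) * P (V @^-1` B))%E.

Definition exchangeable (R : realType) (d : nat) (C : d.-tuple R -> R) : Prop :=
  forall (s : 'S_d) (u : d.-tuple R), unit_cube u ->
    C [tuple tnth u (s j) | j < d] = C u.

Definition le_on (R : realType) (d : nat) (I : {set 'I_d}) (x y : d.-tuple R) :
  Prop := forall j, j \in I -> tnth x j <= tnth y j.

Definition kappa (R : realType) (d : nat) (disp : measure_display)
    (T : measurableType disp) (P : probability T R)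
    (U V : {RV P >-> d.-tuple R}) (I : {set 'I_d}) : \bar R :=
  if (2 <= #|I|)%N then P [set t | le_on I (U t) (V t) \/ le_on I (V t) (U t)]
  else 1%E.

(* The concordance probabilities depend only on [C], so all realizations of [C]
   by a random vector [U] and an independent copy [V] are quantified over; a
   copula has one, on the square of any probability space carrying it. *)
Definition equiconcordant (R : realType) (d : nat) (C : d.-tuple R -> R) :
    Prop :=
  forall (disp : measure_display) (T : measurableType disp)
         (P : probability T R) (U V : {RV P >-> d.-tuple R}),
    follows U C -> follows V C -> independent U V ->
    forall I I' : {set 'I_d}, ~~ odd #|I| -> ~~ odd #|I'| -> #|I| = #|I'| ->
      kappa U V I = kappa U V I'.

(* Zero-based indices: [k] and [j] stand for k+1 and j+1. The leftmost of the d
   digits is the most significant one, so digit [j] has weight 2^(d-1-j). *)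
Definition sdigit (d : nat) (k : 'I_(2 ^ d.-1)) (j : 'I_d) : bool :=
  odd (k %/ 2 ^ (d - j.+1)).

Definition Jset (d : nat) (k : 'I_(2 ^ d.-1)) : {set 'I_d} :=
  [set j | ~~ sdigit k j]%SET.

Definition eta (d : nat) (k : 'I_(2 ^ d.-1)) : nat :=
  maxn #|Jset k| #|~: Jset k|.

(* The default 1 is the convention for the empty minimum; it has no effect on
   nonempty minima over the unit cube. *)
Definition mincoord (R : realType) (d : nat) (J : {set 'I_d}) (u : d.-tuple R) :
  R := \big[Num.min/1]_(j in J) tnth u j.

Definition extremal_copula (R : realType) (d : nat) (k : 'I_(2 ^ d.-1))
    (u : d.-tuple R) : R :=
  Num.max (mincoord (Jset k) u + mincoord (~: Jset k) u - 1) 0.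

Definition extremal_mixture_copula (R : realType) (d : nat)
    (w : 'I_(2 ^ d.-1) -> R) (C : d.-tuple R -> R) : Prop :=
  [/\ copula C,
      forall k, 0 <= w k,
      \sum_k w k = 1 &
      forall u, unit_cube u -> C u = \sum_k w k * extremal_copula k u].

(* Main.v *)
From HB Require Import structures.
Require Import Defs.
From mathcomp Require Import all_boot all_order all_algebra all_fingroup.
From mathcomp Require Import reals.
From mathcomp Require Import lra zify.
Set Implicit Arguments.
Unset Strict Implicit.
Unset Printing Implicit Defensive.
Import Order.TTheory GRing.Theory Num.Theory.
Local Open Scope ring_scope.

(** The extremal copula indexed by [J] is the law of the random vector whose
    coordinates are [x] on [J] and [1 - x] off [J], with [x] uniform on the unit
    interval.  Call a set [I] of coordinates one-sided for [J] when it does not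
    meet both [J] and its complement, so that the coordinates in [I] all move
    together.  Everything is read off from the one-sided weights
    [one_sided_weight w I], the total weight of those components for which [I]
    is one-sided.

    These weights are values of the copula: at the point with coordinates 1/2 on
    [I] and 1 elsewhere, the mixture equals half the one-sided weight of [I]
    ([mixture_half_on]).  They are also the concordance probabilities
    ([concordance_probability]), although these are quadratic in the weights.
    Indeed, for independent vectors drawn from the components [k] and [l] and
    driven by uniform [x] and [y], concordance on [I] is certain if [I] is
    one-sided for both, and has probability zero if it is so for neither.  If it
    is one-sided for [k] only, it means that [x] is at least as far from 1/2 as
    [y]; for the exchanged pair [(l, k)] it means the reverse.  So the
    probabilities for [(k, l)] and [(l, k)] always add up to the number of those
    among [k] and [l] for which [I] is one-sided ([concordance_sum]), and
    summing over all pairs leaves an expression linear in the weights.  This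
    uses that the distribution function on the cube determines the law
    ([law_of_follows]), hence the joint law of independent copies
    ([joint_law]).

    Exchangeability makes the one-sided weight of [I] depend on the cardinality
    of [I] only, which gives equiconcordance.  Conversely, an independent pair
    exists ([independent_copy]), so equiconcordance says that the one-sided
    weights of even sets depend on cardinality only.  Spread every weight
    symmetrically over the two sets [J_k] and its complement: one-sided weights
    become the sums over all supersets of [I], and invariance under
    complementation lets inclusion-exclusion recover the odd sets from the even
    ones ([symmetric_upper_sums_eq0]).  Therefore the even one-sided weights
    determine all weights, and by permuting coordinates, a weight depends only
    on the cardinalities of [J_k] and its complement, that is on [eta k].
    Finally, if the weights depend on [eta k] only, a permutation of coordinates
    merely permutes the components of equal weight. *)

(** * Functions on sets determined by their sums over supersets *)

Definition one_sided (T : finType) (I S : {set T}) :=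
  (I \subset S) || (I \subset ~: S).

Section Sets.
Variables (R : numFieldType) (T : finType).
Implicit Types (f : {set T} -> R) (A B I S : {set T}).

Lemma sum_sign_subsets I :
  \sum_(A : {set T} | A \subset I) (-1) ^+ #|A| = (I == set0)%:R :> R.
Proof.
have [->|/set0Pn[x xI]] := eqVneq I set0.
  rewrite (big_pred1 set0) ?cards0 ?expr0// => A /=; exact: subset0.
(* The subsets containing x are paired with those that do not. *)
rewrite (bigID (fun A => x \in A)) /=.
rewrite (reindex_onto (fun A => x |: A) (fun A => A :\ x)) /=; last first.
  by move=> A /andP[_ xA]; rewrite setD1K.
rewrite (eq_bigl (fun A => (A \subset I) && (x \notin A))); last first.
  move=> A; rewrite setU11 andbT subUset sub1set xI /=; congr (_ && _).
  apply/eqP/idP => [<-|xA]; first by rewrite !inE eqxx.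
  by rewrite setU1K.
rewrite -big_split /= big1// => A /andP[_ xA].
by rewrite cardsU1 xA exprS mulN1r addNr.
Qed.

(** Let [g I] be the sum of [f] over the supersets of [I]. By
    inclusion-exclusion, the signed sum of [g] over the subsets of [I] is the
    sum of [f] over the sets disjoint from [I]; complementation turns it into
    [g I] again. For [I] of odd cardinality the term of [I] itself enters with
    the opposite sign, so [2 * g I] is a combination of values of [g] at
    proper subsets, and vanishing at even sets propagates to all sets. *)
Lemma symmetric_upper_sums_eq0 f :
    (forall S, f (~: S) = f S) ->
    (forall I, ~~ odd #|I| -> \sum_(S : {set T} | I \subset S) f S = 0) ->
  forall S, f S = 0.
Proof.
move=> fC g0.
pose g I := \sum_(S : {set T} | I \subset S) f S.
have incl_excl I : \sum_(A : {set T} | A \subset I) (-1) ^+ #|A| * g A = g I.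
  transitivity (\sum_(S : {set T} | I :&: S == set0) f S).
    under eq_bigr do rewrite mulr_sumr.
    rewrite (exchange_big_dep predT)//= [RHS]big_mkcond/=.
    apply: eq_bigr => S _.
    rewrite -mulr_suml (eq_bigl (fun A => A \subset I :&: S)); last first.
      by move=> A; rewrite subsetI.
    by rewrite sum_sign_subsets; case: eqP => _; rewrite ?mul1r ?mul0r.
  rewrite (reindex_inj (@setC_inj T)) /=; under eq_bigr do rewrite fC.
  by apply: eq_bigl => S; rewrite -setDE setD_eq0.
(* Strong induction on the cardinality of the set. *)
have gE0 n : forall I, (#|I| < n)%N -> g I = 0.
  elim: n => // n IH I; rewrite ltnS => In.
  case: (boolP (odd #|I|)) => [Iodd|/g0//].
  have := incl_excl I; rewrite (bigD1 I)//= big1 ?addr0; last first.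
    move=> A; rewrite andbC -properEneq => /proper_card AI.
    by rewrite IH ?mulr0// (leq_trans AI).
  rewrite -signr_odd Iodd expr1 mulN1r => /eqP.
  by rewrite eq_sym -addr_eq0 -mulr2n mulrn_eq0 /= => /eqP.
(* [f] is recovered from [g] by descending from the full set. *)
have fE0 n : forall S, (#|~: S| < n)%N -> f S = 0.
  elim: n => // n IH S; rewrite ltnS => Sn.
  have := gE0 _ S (ltnSn #|S|); rewrite /g (bigD1 S)//= big1 ?addr0//.
  move=> S' /andP[SS' nSS']; apply: IH; apply: leq_trans Sn.
  by apply: proper_card; rewrite properC properEneq eq_sym nSS'.
by move=> S; exact: fE0 (ltnSn _).
Qed.

(** Transposing an element of [A] outside [B] with one of [B] outside [A] brings
    the two sets closer. *)
Lemma perm_imset_card A B : #|A| = #|B| -> exists p : {perm T}, p @: A = B.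
Proof.
move En : #|A :\: B| => n; elim: n => [|n IH] in A En * => AB.
  exists 1%g; apply/eqP; rewrite eqEcard.
  have -> : [set (1%g : {perm T}) x | x in A] = A.
    by rewrite (eq_imset _ (@perm1 T)) imset_id.
  by rewrite -setD_eq0 -cards_eq0 En AB leqnn.
have /card_gt0P[x] : (0 < #|A :\: B|)%N by rewrite En.
have /card_gt0P[y] : (0 < #|B :\: A|)%N.
  have := cardsID B A; have := cardsID A B; rewrite En setIC AB => <-; lia.
rewrite !inE => /andP[yA yB] /andP[xB xA].
have [p pE] : exists p : {perm T}, p @: (tperm x y @: A) = B.
  apply: IH; last by rewrite card_imset//; exact: perm_inj.
  have -> : tperm x y @: A :\: B = (A :\: B) :\ x.
    apply/setP => z; rewrite !inE.
    have -> : (z \in [set tperm x y i | i in A]) = (tperm x y z \in A).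
      by rewrite -{1}[z](tpermK x y) mem_imset//; exact: perm_inj.
    case: tpermP => [->|->|/eqP zx /eqP zy]; rewrite ?eqxx /=.
    - by rewrite (negbTE yA) andbF.
    - by rewrite yB (negbTE yA) !andbF.
    - by rewrite zx.
  by have := cardsD1 x (A :\: B); rewrite !inE xB xA En add1n => -[<-].
exists (tperm x y * p)%g; rewrite -pE -imset_comp.
by apply: eq_imset => z; rewrite permM.
Qed.

Lemma mem_perm_imset (p : {perm T}) A x : (p x \in p @: A) = (x \in A).
Proof. by rewrite mem_imset//; exact: perm_inj. Qed.

Lemma perm_imsetC (p : {perm T}) A : p @: (~: A) = ~: (p @: A).
Proof.
by apply/setP => x; rewrite -(permKV p x) inE !mem_perm_imset inE.
Qed.

Lemma perm_imset_inj (p : {perm T}) : injective (fun A => p @: A).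
Proof. exact/imset_inj/perm_inj. Qed.

(** For a permutation [p], the function [S |-> f S - f (p @: S)] is symmetric
    and its sums over the supersets of even sets vanish. *)
Lemma symmetric_upper_sums_card f :
    (forall S, f (~: S) = f S) ->
    (forall I I' : {set T}, ~~ odd #|I| -> ~~ odd #|I'| -> #|I| = #|I'| ->
       \sum_(S : {set T} | I \subset S) f S
         = \sum_(S : {set T} | I' \subset S) f S) ->
  forall S S', #|S| = #|S'| -> f S = f S'.
Proof.
move=> fC fI S _ /perm_imset_card[p <-].
have cardp A : #|p @: A| = #|A| by rewrite card_imset//; exact: perm_inj.
apply/eqP; rewrite -subr_eq0; apply/eqP.
apply: (@symmetric_upper_sums_eq0 (fun S => f S - f (p @: S))) => [X|I Ie].
  by rewrite fC perm_imsetC fC.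
rewrite sumrB (fI I (p @: I)) ?cardp//.
rewrite [X in X - _](reindex_inj (@perm_imset_inj p)) /=.
rewrite [X in X - _](eq_bigl (fun S => I \subset S)) ?subrr// => X.
apply/subsetP/subsetP => IX x; last first.
  by rewrite -(permKV p x) !mem_perm_imset; exact: IX.
by have := IX (p x); rewrite !mem_perm_imset.
Qed.
End Sets.

(** * The index sets of the extremal copulas *)

Lemma binary_digits_inj n a b : (a < 2 ^ n)%N -> (b < 2 ^ n)%N ->
  (forall i, (i < n)%N -> odd (a %/ 2 ^ i) = odd (b %/ 2 ^ i)) -> a = b.
Proof.
elim: n a b => [|n IH] a b.
  by rewrite expn0 !ltnS !leqn0 => /eqP-> /eqP->.
move=> an bn ab; rewrite -(odd_double_half a) -(odd_double_half b).
congr (_ + _.*2)%N; first by have := ab 0 isT; rewrite !divn1 => ->.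
apply: IH => [||i ltin].
- by rewrite -divn2 ltn_divLR// -expnSr.
- by rewrite -divn2 ltn_divLR// -expnSr.
- by have := ab i.+1 ltin; rewrite expnS !divnMA !divn2.
Qed.

Section IndexSets.
Variable d : nat.
Implicit Types (k l : 'I_(2 ^ d.+1.-1)) (S : {set 'I_d.+1}).

Lemma ord0_Jset k : ord0 \in Jset k.
Proof. by rewrite inE /sdigit subn1 divn_small. Qed.

Lemma Jset_inj : injective (@Jset d.+1).
Proof.
move=> k l kl; apply: val_inj.
apply: (binary_digits_inj (ltn_ord k) (ltn_ord l)) => i id.
have jd : (d - i < d.+1)%N by rewrite ltnS leq_subr.
have := congr1 (fun A : {set 'I_d.+1} => Ordinal jd \in A) kl.
rewrite !inE /sdigit /= => /negb_inj.
by rewrite subSS subKn// ltnW.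
Qed.

Lemma Jset_neqC k l : Jset k != ~: Jset l.
Proof.
apply/eqP => kl; have := ord0_Jset k.
by rewrite kl inE ord0_Jset.
Qed.

(** As the leading digit is always zero, the sets [Jset k] contain the first
    coordinate, and they and their complements are [2 ^ d.+1] distinct sets:
    as many as there are sets of coordinates. *)
Lemma Jset_cover S : exists k, S = Jset k \/ S = ~: Jset k.
Proof.
pose F (x : bool * 'I_(2 ^ d)) : {set 'I_d.+1} :=
  if x.1 then @Jset d.+1 x.2 else ~: @Jset d.+1 x.2.
have F_inj : injective F.
  move=> [[] k] [[] l]; rewrite /F /=.
  - by move/Jset_inj ->.
  - by move/eqP; rewrite (negbTE (Jset_neqC _ _)).
  - by move/eqP; rewrite eq_sym (negbTE (Jset_neqC _ _)).
  - by move/setC_inj/Jset_inj ->.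
have cardE : #|{set 'I_d.+1}| = #|{: bool * 'I_(2 ^ d)}|.
  rewrite card_prod card_bool card_ord -cardsT -powersetT.
  by rewrite card_powerset cardsT card_ord expnS.
have [G _ FG] := inj_card_bij F_inj (eq_leq cardE).
exists (G S).2; rewrite -{1 3}(FG S) /F.
by case: (G S).1; [left|right].
Qed.
End IndexSets.

(** * Mixture weights seen as symmetric functions on sets *)

Section Folding.
Variables (R : numFieldType) (T K : finType) (J : K -> {set T}) (w : K -> R).

(** Spreading each weight over both [J k] and its complement replaces sums over
    indices by sums over all sets, on which permutations of coordinates act. *)
Definition folded_weight (S : {set T}) : R :=
  \sum_k w k * ((J k == S)%:R + (~: J k == S)%:R).

Lemma folded_weightC S : folded_weight (~: S) = folded_weight S.
Proof.
apply: eq_bigr => k _; rewrite addrC (inj_eq (@setC_inj T)).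
by rewrite -[in X in _ + X](setCK (J k)) (inj_eq (@setC_inj T)).
Qed.

Lemma sum_folded_weight (P : pred {set T}) (G : {set T} -> R) :
  \sum_(S : {set T} | P S) folded_weight S * G S
   = \sum_k w k * ((P (J k))%:R * G (J k) + (P (~: J k))%:R * G (~: J k)).
Proof.
under eq_bigr do rewrite mulr_suml.
rewrite exchange_big; apply: eq_bigr => k _.
under eq_bigr do rewrite -mulrA.
rewrite -mulr_sumr; congr (_ * _).
under eq_bigr do rewrite mulrDl.
have one A : \sum_(S : {set T} | P S) (A == S)%:R * G S = (P A)%:R * G A.
  rewrite big_mkcond (bigD1 A)//= big1 => [|S /negbTE SA].
    by rewrite eqxx mul1r addr0; case: (P A); rewrite ?mul1r ?mul0r.
  by rewrite eq_sym SA mul0r if_same.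
by rewrite big_split /= !one.
Qed.
End Folding.

Section ExtremalMixtures.
Variables (R : realType) (d : nat) (w : 'I_(2 ^ d.+1.-1) -> R).
Implicit Types (k l : 'I_(2 ^ d.+1.-1)) (S I : {set 'I_d.+1}).

Let f := folded_weight (@Jset d.+1) w.

Lemma folded_weight_Jset k : f (Jset k) = w k.
Proof.
rewrite /f /folded_weight (bigD1 k)//= eqxx eq_sym (negbTE (Jset_neqC _ _)).
rewrite addr0 mulr1 big1 ?addr0// => l lk.
rewrite (inj_eq (@Jset_inj d)) (negbTE lk) eq_sym (negbTE (Jset_neqC _ _)).
by rewrite addr0 mulr0.
Qed.

Definition one_sided_weight I : R := \sum_k w k * (one_sided I (Jset k))%:R.

Lemma folded_upper_sum I : I != set0 ->
  \sum_(S : {set 'I_d.+1} | I \subset S) f S = one_sided_weight I.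
Proof.
move=> /set0Pn[i iI].
under eq_bigr do rewrite -[f _]mulr1.
rewrite (@sum_folded_weight _ _ _ _ _ _ (fun=> 1)); apply: eq_bigr => k _.
rewrite !mulr1 /one_sided; congr (_ * _).
case: (boolP (I \subset Jset k)) => [/subsetP IJ|_] /=; last by rewrite add0r.
case: (boolP (I \subset ~: Jset k)) => [/subsetP/(_ _ iI)|_].
  by rewrite inE IJ.
by rewrite addr0.
Qed.

(** For nonempty [I], [one_sided_weight I] is the sum of the folded weight over
    the supersets of [I], so that [symmetric_upper_sums_card] applies; and
    [eta k] determines the cardinality of [Jset k] up to exchanging the set with
    its complement. *)
Lemma weights_eta_of_one_sided :
    (forall I I' : {set 'I_d.+1},
       (2 <= #|I|)%N -> ~~ odd #|I| -> #|I| = #|I'| ->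
       one_sided_weight I = one_sided_weight I') ->
  forall k l, eta k = eta l -> w k = w l.
Proof.
move=> wI.
have fE : forall S S', #|S| = #|S'| -> f S = f S'.
  apply: symmetric_upper_sums_card => [|I I' Ie _ II'].
    exact: folded_weightC.
  have [I0|I0] := eqVneq I set0.
    by move: II'; rewrite I0 cards0 => /esym/eqP; rewrite cards_eq0 => /eqP->.
  have cI : (2 <= #|I|)%N.
    by move: I0 Ie; rewrite -card_gt0; case: #|I| => // -[].
  rewrite !folded_upper_sum//; first exact: wI.
  by rewrite -card_gt0 -II'; apply: leq_trans cI.
move=> k l; rewrite /eta => kl.
rewrite -(folded_weight_Jset k) -(folded_weight_Jset l).
have kE := cardsC (Jset k); have lE := cardsC (Jset l).
have [kl'|kl'] : #|Jset k| = #|Jset l| \/ #|Jset k| = #|~: Jset l|.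
- move: kl kE lE; rewrite !card_ord; lia.
- exact: fE.
- by rewrite -[RHS]folded_weightC; exact: fE.
Qed.

End ExtremalMixtures.

(** * Exchangeability of mixtures of extremal copulas *)

(** The extremal copula for an arbitrary set of coordinates: [extremal_copula k]
    is the case of [Jset k].  A permutation of coordinates need not preserve the
    sets that contain the first coordinate. *)
Definition antithetic_copula (R : realType) (d : nat) (S : {set 'I_d})
    (u : d.-tuple R) : R :=
  Num.max (mincoord S u + mincoord (~: S) u - 1) 0.

Section ExtremalCopulas.
Variables (R : realType) (d : nat).
Implicit Types (k l : 'I_(2 ^ d.+1.-1)) (S I : {set 'I_d.+1}).
Implicit Types (u : d.+1.-tuple R) (s : 'S_d.+1) (w : 'I_(2 ^ d.+1.-1) -> R).

Lemma antithetic_copulaC S u :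
  antithetic_copula (~: S) u = antithetic_copula S u.
Proof. by rewrite /antithetic_copula setCK [X in X - 1]addrC. Qed.

Lemma mincoord_perm s S u :
  mincoord S [tuple tnth u (s j) | j < d.+1] = mincoord (s @: S) u.
Proof.
rewrite /mincoord [RHS](reindex_inj (@perm_inj _ s)).
by apply: eq_big => [j|j _]; rewrite ?mem_perm_imset// tnth_mktuple.
Qed.

Lemma antithetic_copula_perm s S u :
  antithetic_copula S [tuple tnth u (s j) | j < d.+1] =
  antithetic_copula (s @: S) u.
Proof. by rewrite /antithetic_copula !mincoord_perm perm_imsetC. Qed.

(** Twice the mixture is the sum over all sets [S] of the folded weight of [S]
    times the copula of [S].  Permuting the coordinates permutes the sets [S]
    and preserves the folded weight. *)
Lemma exchangeable_of_weights_eta w (C : d.+1.-tuple R -> R) :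
  (forall u, unit_cube u -> C u = \sum_k w k * extremal_copula k u) ->
  (forall k l, eta k = eta l -> w k = w l) -> exchangeable C.
Proof.
move=> CE w_eta s u u01.
have su01 : unit_cube [tuple tnth u (s j) | j < d.+1].
  by move=> j; rewrite tnth_mktuple.
rewrite !CE//.
pose f := folded_weight (@Jset d.+1) w.
have sumE v : \sum_S f S * antithetic_copula S v =
              2%:R * \sum_k w k * extremal_copula k v.
  rewrite /f sum_folded_weight mulr_sumr; apply: eq_bigr => k _.
  by rewrite antithetic_copulaC !mul1r mulrCA mulr_natl mulr2n.
have fs S : f (s @: S) = f S.
  have cs (A : {set 'I_d.+1}) : #|s @: A| = #|A|.
    by rewrite card_imset//; exact: perm_inj.
  have [k Sk] := Jset_cover S; have [l Sl] := Jset_cover (s @: S).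
  have fk : f S = w k.
    by case: Sk => ->; rewrite ?/f ?folded_weightC folded_weight_Jset.
  have fl : f (s @: S) = w l.
    by case: Sl => ->; rewrite ?/f ?folded_weightC folded_weight_Jset.
  rewrite fk fl; apply: w_eta.
  have etaE (X : {set 'I_d.+1}) m : X = Jset m \/ X = ~: Jset m ->
      eta m = maxn #|X| #|~: X|.
    by case=> ->; rewrite /eta ?setCK// maxnC.
  by rewrite (etaE _ _ Sk) (etaE _ _ Sl) -perm_imsetC !cs.
apply: (@mulfI _ 2%:R); first by rewrite pnatr_eq0.
rewrite -!sumE [RHS](reindex_inj (@perm_imset_inj _ s)).
by apply: eq_bigr => S _; rewrite fs antithetic_copula_perm.
Qed.

(** A point at which each extremal copula tells whether [I] is one-sided: the
    two minima are 1/2 and 1 if it is, and both are 1/2 if it is not. *)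
Definition half_on I : d.+1.-tuple R :=
  [tuple if j \in I then 2^-1 else 1 | j < d.+1].

Lemma half_on_cube I : unit_cube (half_on I).
Proof. move=> j; rewrite tnth_mktuple; case: ifP => _; lra. Qed.

Lemma mincoord_half_on I S :
  mincoord S (half_on I) = if I :&: S == set0 then 1 else 2^-1.
Proof.
have ge j : 2^-1 <= tnth (half_on I) j.
  by rewrite tnth_mktuple; case: ifP => _; lra.
case: ifPn => [/eqP IS|/set0Pn[j]].
  apply: bigmin_eq_id => j jS; rewrite tnth_mktuple ifN//.
  by apply: contra_eqN IS => jI; apply/set0Pn; exists j; rewrite inE jI.
rewrite inE => /andP[jI jS]; apply/le_anti/andP; split.
  by apply: (@bigmin_inf _ _ _ _ j) => //; rewrite tnth_mktuple jI.
by apply: le_bigmin => [|i _]; [lra|exact: ge].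
Qed.

Lemma antithetic_copula_half_on I S : I != set0 ->
  antithetic_copula S (half_on I) = (one_sided I S)%:R / 2.
Proof.
move=> I0; rewrite /antithetic_copula !mincoord_half_on /one_sided.
rewrite orbC -setD_eq0 setDE setCK -(setD_eq0 I S) setDE.
have : ~~ ((I :&: S == set0) && (I :&: ~: S == set0)).
  apply: contra I0 => /andP[/eqP IS /eqP IS'].
  by rewrite -(setID I S) setDE IS IS' setU0.
case: eqP => _; case: eqP => //= _ _.
- rewrite max_l; lra.
- rewrite max_l; lra.
- rewrite max_r; lra.
Qed.

Lemma mixture_half_on w (C : d.+1.-tuple R -> R) I :
    (forall u, unit_cube u -> C u = \sum_k w k * extremal_copula k u) ->
    I != set0 ->
  C (half_on I) = one_sided_weight w I / 2.
Proof.
move=> CE I0; rewrite CE; last exact: half_on_cube.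
rewrite /one_sided_weight mulr_suml; apply: eq_bigr => k _.
by rewrite [extremal_copula _ _]antithetic_copula_half_on// mulrA.
Qed.

Lemma one_sided_weight_exchangeable w (C : d.+1.-tuple R -> R) I I' :
    (forall u, unit_cube u -> C u = \sum_k w k * extremal_copula k u) ->
    exchangeable C -> I != set0 -> #|I| = #|I'| ->
  one_sided_weight w I = one_sided_weight w I'.
Proof.
move=> CE exC I0 II'.
have I'0 : I' != set0 by rewrite -card_gt0 -II' card_gt0.
apply: (@mulIf _ 2^-1); first by rewrite invr_eq0 pnatr_eq0.
rewrite -!(mixture_half_on CE)//.
have /perm_imset_card[s sI'] := esym II'.
rewrite -(exC s _ (half_on_cube I)); congr C; apply: eq_from_tnth => j.
by rewrite !tnth_mktuple -sI' mem_perm_imset.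
Qed.
End ExtremalCopulas.

(** * Laws on the unit cube *)

From mathcomp Require Import all_classical all_reals all_analysis.
From mathcomp Require Import measurable_realfun.
Import Order.TTheory GRing.Theory Num.Theory.
Local Open Scope classical_set_scope.
Local Open Scope ring_scope.

Lemma measurable_forall_fin (disp : measure_display)
    (T : measurableType disp) (I : finType) (P : I -> set T) :
  (forall i, measurable (P i)) -> measurable [set x | forall i, P i x].
Proof.
move=> mP.
have -> : [set x | forall i, P i x] = \bigcap_(i in [set: I]) P i.
  by apply/seteqP; split=> x /= Px i; [move=> _|]; exact: Px.
exact: fin_bigcap_measurable.
Qed.

Lemma measure_setD_null (R : realType) (disp : measure_display)
    (T : measurableType disp)
    (m : {measure set T -> \bar R}) (A N : set T) :
  measurable A -> measurable N -> m N = 0%E -> m A = m (A `\` N).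
Proof.
move=> mA mN N0; rewrite -[in LHS](setDUK (@subIsetl _ A N)).
rewrite setUC measureU0//; first by rewrite setDIr setDv set0U.
- by rewrite setDIr setDv set0U; exact: measurableD.
- exact: measurableI.
- by apply: (subset_measure0 _ _ _ N0) => //; exact: measurableI.
Qed.

Section Boxes.
Variables (R : realType) (d : nat).
Implicit Types (u x : d.-tuple R).

(** Lower orthants are closed under intersection and generate the product
    sigma-algebra, so a finite measure is determined by its values on them. *)
Definition box u : set (d.-tuple R) := [set x | forall j, tnth x j <= tnth u j].

Lemma boxI u v :
  box u `&` box v = box [tuple Num.min (tnth u j) (tnth v j) | j < d].
Proof.
apply/seteqP; split=> x /=.
  by move=> [xu xv] j; rewrite tnth_mktuple le_min xu xv.
move=> xuv; split=> j; have := xuv j;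
  by rewrite tnth_mktuple le_min => /andP[].
Qed.

Lemma boxes_cover : \bigcup_n box [tuple n%:R | j < d] = setT.
Proof.
apply/seteqP; split=> // x _.
exists (\max_(j < d) Num.truncn (tnth x j)).+1 => //= j.
rewrite tnth_mktuple; apply: le_trans (ltW (truncnS_gt _)) _.
by rewrite ler_nat ltnS (leq_bigmax j).
Qed.

Lemma measurable_coord j (A : set R) :
  measurable A -> measurable [set x : d.-tuple R | A (tnth x j)].
Proof.
move=> mA; have := @measurable_tnth _ (measurableTypeR R) d j measurableT A mA.
by rewrite setTI.
Qed.

Lemma measurable_box u : measurable (box u).
Proof.
apply: measurable_forall_fin => j.
have := @measurable_coord j `]-oo, (tnth u j)]%classic (measurable_itv _).
by congr measurable; apply/seteqP; split=> x /=; rewrite in_itv.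
Qed.

Lemma measurable_tuple_boxes :
  measurable = <<s range box >> :> set (set (d.-tuple R)).
Proof.
apply/seteqP; split; last first.
  apply: smallest_sub; first exact: sigma_algebra_measurable.
  by move=> _ [u _ <-]; exact: measurable_box.
apply: smallest_sub; first exact: smallest_sigma_algebra.
move=> A; rewrite -bigcup_seq => -[j _ [B mB <-]] {A}.
have : image_set_system setT (fun x : d.-tuple R => tnth x j)
    (<<s range box >>) B.
  have /seteqP[/(_ _ mB) mB' _] := @RGenOInfty.measurableE R.
  move: B mB' {mB}; apply: smallest_sub.
    by apply: sigma_algebra_image; exact: smallest_sigma_algebra.
  move=> _ [a ->]; rewrite /image_set_system /= setTI.
  (* The half-space where coordinate [j] is at most [a] is the increasing union
     of the boxes whose other coordinates are bounded by [n]. *)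
  have -> : (fun x : d.-tuple R => tnth x j) @^-1` `]a, +oo[ =
    ~` \bigcup_n box [tuple if i == j then a else n%:R | i < d].
    apply/seteqP; split=> x /=; rewrite in_itv/= andbT.
      move=> ax [n _ /(_ j)]; rewrite tnth_mktuple eqxx => xa.
      by move: (lt_le_trans ax xa); rewrite ltxx.
    move=> nx; rewrite ltNge; apply/negP => xa; apply: nx.
    have [n _ xn] : (\bigcup_n box [tuple n%:R | j < d]) x.
      by rewrite boxes_cover.
    exists n => // i; rewrite tnth_mktuple; case: eqP => [->//|_].
    by have := xn i; rewrite tnth_mktuple.
  have [_ sC sU] := smallest_sigma_algebra [set: d.-tuple R] (range box).
  rewrite -setTD; apply: sC; apply: sU => n.
  apply: sub_sigma_algebra.
  by exists [tuple if i == j then a else n%:R | i < d].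
by [].
Qed.

Definition cube : set (d.-tuple R) := [set u | unit_cube u].

Lemma box_cube_cases u : (box u `&` cube = set0) \/
  exists2 v, unit_cube v & box u `&` cube = box v `&` cube.
Proof.
have [[j uj]|n] := pselect (exists j, tnth u j < 0); [left|right].
  apply/seteqP; split=> // x [/= xu xc]; have /andP[x0 _] := xc j.
  by have := le_lt_trans (le_trans x0 (xu j)) uj; rewrite ltxx.
exists [tuple Num.min (tnth u j) 1 | j < d].
  move=> j; rewrite tnth_mktuple ge_min lexx orbT andbT le_min ler01 andbT.
  by rewrite leNgt; apply/negP => uj; apply: n; exists j.
apply/seteqP; split=> x [xu xc]; split=> // j; have /andP[_ x1] := xc j.
  by rewrite tnth_mktuple le_min xu x1.
by have := xu j; rewrite tnth_mktuple le_min => /andP[].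
Qed.

Lemma measurable_cube : measurable cube.
Proof.
apply: measurable_forall_fin => j.
have := @measurable_coord j `[0, 1]%classic (measurable_itv _).
by congr measurable; apply/seteqP; split=> x /=; rewrite in_itv.
Qed.

(** A measure carried by the cube does not see the part of a box outside of
    it, and inside the cube a box with a corner anywhere is either empty or a
    box with its corner in the cube. *)
Lemma law_on_cube_unique (m1 m2 : {measure set (d.-tuple R) -> \bar R}) :
    (m1 setT < +oo)%E ->
    m1 (~` cube) = 0%E -> m2 (~` cube) = 0%E ->
    (forall u, unit_cube u -> m1 (box u) = m2 (box u)) ->
  forall A, measurable A -> m1 A = m2 A.
Proof.
move=> m1oo m1c m2c m12.
have inside (m : {measure set (d.-tuple R) -> \bar R}) A :
    m (~` cube) = 0%E -> measurable A -> m A = m (A `&` cube).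
  move=> mc mA; have mQC := measurableC measurable_cube.
  by rewrite (measure_setD_null mA mQC mc) setDE setCK.
apply: (measure_unique (range box) (fun n => box [tuple n%:R | j < d])).
- exact: measurable_tuple_boxes.
- by move=> _ _ [u _ <-] [v _ <-]; rewrite boxI; eexists.
- by move=> n; eexists.
- exact: boxes_cover.
- move=> _ [u _ <-].
  rewrite (inside m1)//; last exact: measurable_box.
  rewrite (inside m2)//; last exact: measurable_box.
  have [->|[v v01 ->]] := box_cube_cases u; first by rewrite !measure0.
  rewrite -(inside m1)//; last exact: measurable_box.
  rewrite -(inside m2)//; last exact: measurable_box.
  exact: m12.
- move=> n; apply: le_lt_trans m1oo; apply: le_measure => //.
  + by rewrite inE; exact: measurable_box.
  + by rewrite inE.
Qed.
End Boxes.

(** * Antithetic vectors and the law of an extremal mixture *)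

Section Mixture.
Local Open Scope ereal_scope.
Context (disp : measure_display) (T : measurableType disp) (R : realType).
Variables (K : finType) (w : K -> {nonneg R}).
Variable m : K -> {measure set T -> \bar R}.

Definition mixture (A : set T) : \bar R := \sum_k (w k)%:num%:E * m k A.

Let mixture0 : mixture set0 = 0.
Proof. by rewrite /mixture big1// => k _; rewrite measure0 mule0. Qed.

Let mixture_ge0 A : 0 <= mixture A.
Proof. by apply: sume_ge0 => k _; rewrite mule_ge0// lee_fin. Qed.

Let mixture_sigma_additive : semi_sigma_additive mixture.
Proof.
move=> F mF tF mUF; rewrite [X in _ --> X](_ : _ =
    lim ((fun n => \sum_(0 <= i < n) mixture (F i)) @ \oo)).
  by apply: is_cvg_ereal_nneg_natsum => k _; exact: mixture_ge0.
rewrite nneseries_sum; last by move=> k n _; rewrite mule_ge0// lee_fin.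
apply: eq_bigr => k _.
by rewrite nneseriesZl ?lee_fin//; congr (_ * _); exact: measure_semi_bigcup.
Qed.

HB.instance Definition _ := isMeasure.Build _ _ _ mixture
  mixture0 mixture_ge0 mixture_sigma_additive.
End Mixture.

Section Spread.
Variables (R : realType) (d : nat).
Implicit Types (S I : {set 'I_d}) (x y : R) (u : d.-tuple R).

Local Notation unif := (uniform_prob (@ltr01 R)).

(** The random vector with law [antithetic_copula S], when [x] is uniform. *)
Definition antithetic S x : d.-tuple R :=
  [tuple if j \in S then x else 1 - x | j < d].

(** The uniform law lives on [measurableTypeR R], whose measurable sets agree
    with those of [R] by conversion but whose display differs; hence the
    explicit domain. *)
Lemma measurable_antithetic S :
  @measurable_fun _ _ (measurableTypeR R) (d.-tuple R) setT (antithetic S).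
Proof.
apply/measurable_fun_tnthP => j.
rewrite (_ : _ \o _ = if j \in S then id else fun x => 1 - x); last first.
  by apply/funext => x /=; rewrite tnth_mktuple; case: ifP.
case: ifP => _; first exact: measurable_id.
exact: measurable_funB.
Qed.

Lemma measurable_antithetic_preimage S (A : set (d.-tuple R)) :
  measurable A -> measurable (antithetic S @^-1` A).
Proof.
by move=> mA; rewrite -[X in measurable X]setTI; exact: measurable_antithetic.
Qed.

Definition antithetic_mfun S : {mfun measurableTypeR R >-> d.-tuple R} :=
  @mfun_Sub _ _ (measurableTypeR R) (d.-tuple R) _
    (mem_set (measurable_antithetic S)).

Lemma uniform_probE (A : set R) : measurable A ->
  unif A = lebesgue_measure (A `&` `[0, 1]).
Proof.
move=> mA; rewrite /uniform_prob integral_uniform_pdf.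
rewrite (eq_integral (fun=> 1%E)); last first.
  move=> x /[!inE] -[_ /=]; rewrite in_itv/= /uniform_pdf => ->.
  by rewrite subr0 invr1.
rewrite integral_cst ?mul1e//.
by apply: measurableI => //; exact: measurable_itv.
Qed.

(** Within the unit interval, the vector lies below [u] exactly when
    [1 - mincoord (~: S) u <= x <= mincoord S u]; the copula is the length of
    this interval. *)
Lemma uniform_prob_antithetic_box S u : unit_cube u ->
  unif (antithetic S @^-1` box u) = (antithetic_copula S u)%:E.
Proof.
move=> u01.
rewrite uniform_probE; last first.
  by apply: measurable_antithetic_preimage; exact: measurable_box.
rewrite /antithetic_copula; set a := mincoord S u; set b := mincoord (~: S) u.
have mc01 X : 0 <= mincoord X u <= 1.
  rewrite bigmin_le_id andbT le_bigmin// => j _.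
  by have /andP[] := u01 j.
have -> : antithetic S @^-1` box u `&` `[0, 1] = `[1 - b, a]%classic.
  apply/seteqP; split=> x /=; rewrite !in_itv/=.
    move=> [xu /andP[x0 x1]]; apply/andP; split.
      suff : 1 - x <= b by lra.
      apply: le_bigmin => [|j]; first lra.
      by rewrite inE => /negbTE jS; have := xu j; rewrite tnth_mktuple jS.
    by apply: le_bigmin => // j jS; have := xu j; rewrite tnth_mktuple jS.
  have /andP[_ a1] := mc01 S; have /andP[_ b1] := mc01 (~: S)%SET.
  move=> /andP[bx xa]; split.
  2: by apply/andP; split; rewrite -/a -/b in a1 b1 *; lra.
  move=> j; rewrite tnth_mktuple; case: ifPn => jS.
    by apply: le_trans xa _; exact: bigmin_le_cond.
  suff : b <= tnth u j by lra.
  by apply: bigmin_le_cond; rewrite inE.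
rewrite lebesgue_measure_itv/= lte_fin; case: ltP => ab.
  rewrite -EFinB; congr EFin; rewrite max_l; lra.
congr EFin; rewrite max_r//; lra.
Qed.

Lemma uniform_prob_antithetic_cubeC S :
  unif (antithetic S @^-1` (~` @cube R d)) = 0%E.
Proof.
rewrite uniform_probE; last first.
  apply: measurable_antithetic_preimage; apply: measurableC.
  exact: measurable_cube.
rewrite (_ : _ `&` _ = set0) ?measure0//; apply/seteqP; split=> // x [/= nc].
rewrite in_itv/= => /andP[x0 x1]; apply: nc => j; rewrite tnth_mktuple.
by case: ifP => _; apply/andP; split; lra.
Qed.

End Spread.

Section Laws.
Variables (R : realType) (d : nat) (K : finType) (J : K -> {set 'I_d}).
Variables (w : K -> R) (C : d.-tuple R -> R).
Hypothesis w0 : forall k, 0 <= w k.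
Hypothesis CE : forall u, unit_cube u -> C u =
  \sum_k w k * antithetic_copula (J k) u.

Local Notation unif := (uniform_prob (@ltr01 R)).

(** The values of a distribution function on the cube say nothing about what
    lies outside it; the uniform margins put no mass there. *)
Lemma follows_cubeC (disp : measure_display) (T : measurableType disp)
    (P : probability T R) (U : {RV P >-> d.-tuple R}) :
  follows U C -> P (U @^-1` (~` @cube R d)) = 0%E.
Proof.
move=> [Umarg _].
have mI : measurable (~` `[0, 1]%classic : set R).
  by apply: measurableC; exact: measurable_itv.
have mU A : measurable A -> measurable (U @^-1` A).
  by move=> mA; rewrite -[X in measurable X]setTI; exact: measurable_funP.
apply/eqP; rewrite -measure_le0.
have h := @content_sub_fsum _ R T P 'I_d setT (U @^-1` (~` @cube R d))
  (fun j => [set t | (~` `[0, 1]%classic : set R) (tnth (U t) j)]).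
apply: le_trans (h _ _ _ _) _.
- exact: finite_finset.
- by move=> j _; exact: (mU _ (measurable_coord j mI)).
- by apply: mU; apply: measurableC; exact: measurable_cube.
- by move=> t /= /existsNP[j Uj]; exists j => //=; rewrite in_itv.
- rewrite fsbig1// => j _; rewrite [LHS](Umarg j _ mI) uniform_probE//.
  by rewrite setICl measure0.
Qed.

Definition antithetic_law :=
  mixture (fun k => NngNum (w0 k))
    (fun k => distribution unif (antithetic_mfun R (J k))).

Lemma law_of_follows (disp : measure_display) (T : measurableType disp)
    (P : probability T R) (U : {RV P >-> d.-tuple R}) :
  follows U C -> forall A, measurable A -> P (U @^-1` A) = antithetic_law A.
Proof.
move=> fU; have [_ Ucdf] := fU.
apply: (@law_on_cube_unique R d (distribution P U) antithetic_law).
- by rewrite [X in (X < _)%E](probability_setT (distribution P U)) ltry.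
- exact: follows_cubeC.
- rewrite /antithetic_law/= /mixture big1// => k _.
  by rewrite [X in (_ * X)%E]uniform_prob_antithetic_cubeC mule0.
- move=> u u01; rewrite [LHS](Ucdf u u01) CE// -sumEFin.
  apply: eq_bigr => k _; rewrite EFinM; congr (_ * _)%E.
  by rewrite -uniform_prob_antithetic_box.
Qed.

Definition antithetic_pair (S S' : {set 'I_d}) (z : R * R) :
  d.-tuple R * d.-tuple R := (antithetic S z.1, antithetic S' z.2).

Lemma measurable_antithetic_pair S S' :
  @measurable_fun _ _ (measurableTypeR R * measurableTypeR R)%type
    (d.-tuple R * d.-tuple R)%type setT (antithetic_pair S S').
Proof.
by apply: measurable_fun_pair; apply: measurableT_comp => //;
  exact: measurable_antithetic.
Qed.

Definition antithetic_pair_mfun S S' :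
    {mfun (measurableTypeR R * measurableTypeR R)%type >->
      (d.-tuple R * d.-tuple R)%type} :=
  @mfun_Sub _ _ (measurableTypeR R * measurableTypeR R)%type
    (d.-tuple R * d.-tuple R)%type _
    (mem_set (measurable_antithetic_pair S S')).

Definition antithetic_pair_law :=
  mixture (fun kl : K * K => NngNum (mulr_ge0 (w0 kl.1) (w0 kl.2)))
    (fun kl => distribution (unif \x unif)%E
       (antithetic_pair_mfun (J kl.1) (J kl.2))).

(** Both sides are the product of the laws of [U] and [V], because a product
    measure is determined by its values on rectangles: the left one by
    independence, the right one by expanding the product of two mixtures. *)
Lemma joint_law (disp : measure_display) (T : measurableType disp)
    (P : probability T R) (U V : {RV P >-> d.-tuple R}) :
    follows U C -> follows V C -> independent U V ->
  forall A : set (d.-tuple R * d.-tuple R), measurable A ->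
  P [set t | A (U t, V t)] =
  (\sum_k \sum_l (w k * w l)%:E *
     (unif \x unif) (antithetic_pair (J k) (J l) @^-1` A))%E.
Proof.
move=> fU fV UV A mA.
pose W t := (U t, V t).
have mW : measurable_fun setT W by apply: measurable_fun_pair.
pose Wf := mfun_Sub (mem_set mW).
have lawE : antithetic_pair_law A = (\sum_k \sum_l (w k * w l)%:E *
     (unif \x unif) (antithetic_pair (J k) (J l) @^-1` A))%E.
  by rewrite pair_bigA.
rewrite -lawE.
have uniq := @product_measure_unique _ _ _ _ R
  (distribution P U) (distribution P V).
transitivity (((distribution P U) \x (distribution P V))%E A).
  by apply/esym/(uniq (distribution P Wf)).
apply: (uniq antithetic_pair_law) => // A1 A2 mA1 mA2.
transitivity (antithetic_law A1 * antithetic_law A2)%E; last first.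
  by congr (_ * _)%E; apply/esym;
    [exact: (law_of_follows fU)|exact: (law_of_follows fV)].
rewrite /antithetic_law /= /mixture ge0_sume_distrl; last first.
  by move=> k _; rewrite mule_ge0// lee_fin.
rewrite -(pair_bigA _ (fun k l => (w k * w l)%:E *
  distribution (unif \x unif)%E (antithetic_pair_mfun (J k) (J l))
    (A1 `*` A2)))%E /=.
apply: eq_bigr => k _.
rewrite ge0_sume_distrr; last by move=> l _; rewrite mule_ge0// lee_fin.
apply: eq_bigr => l _.
rewrite EFinM muleACA; congr (_ * _)%E.
transitivity ((unif \x unif)%E
  ((antithetic (J k) @^-1` A1) `*` (antithetic (J l) @^-1` A2))) => //.
by apply: product_measure1E; exact: measurable_antithetic_preimage.
Qed.
End Laws.

(** * Concordance probabilities *)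

Section Concordance.
Variables (R : realType) (d : nat).
Implicit Types (S I : {set 'I_d}) (x y : R).

Local Notation unif := (uniform_prob (@ltr01 R)).

(** The null set on which two antithetic vectors can share a coordinate. *)
Definition diagonals : set (R * R) := [set z | z.2 = z.1 \/ z.2 = 1 - z.1].

Lemma uniform_prob_set1 (a : R) : unif [set a] = 0%E.
Proof.
rewrite uniform_probE//.
apply: (subset_measure0 _ _ _ (lebesgue_measure_set1 a)) => //.
by apply: measurableI => //; exact: measurable_itv.
Qed.

Lemma measurable_diagonals :
  @measurable _ (measurableTypeR R * measurableTypeR R)%type diagonals.
Proof.
pose T2 := (measurableTypeR R * measurableTypeR R)%type.
have measurable_eq (f g : R * R -> R) :
    @measurable_fun _ _ T2 R setT f -> @measurable_fun _ _ T2 R setT g ->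
    @measurable _ T2 [set z | f z = g z].
  move=> mf mg.
  have -> : [set z | f z = g z] =
      [set z | f z <= g z] `&` [set z | g z <= f z].
    apply/seteqP; split=> z /= => [->//|[fg gf]].
    by apply/le_anti; rewrite fg gf.
  by apply: measurableI; rewrite -[X in measurable X]setTI;
    exact: measurable_fun_le.
have m1 : @measurable_fun _ _ T2 R setT fst by exact: measurable_fst.
have m2 : @measurable_fun _ _ T2 R setT snd by exact: measurable_snd.
apply: measurableU; apply: measurable_eq => //.
exact: measurable_funB.
Qed.

Lemma diagonals_null : (unif \x unif)%E diagonals = 0%E.
Proof.
rewrite [LHS]/product_measure1 integral0_eq// => x _ /=.
have xx0 : unif ([set x] `|` [set 1 - x]) = 0%E.
  rewrite [LHS]measureU0; try exact: measurable_set1.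
    exact: uniform_prob_set1.
  exact: uniform_prob_set1.
apply: (subset_measure0 _ _ _ xx0).
- by apply: measurable_xsection; exact: measurable_diagonals.
- exact: measurableU.
- by move=> y; rewrite /xsection/= inE.
Qed.

Definition concordant I : set (d.-tuple R * d.-tuple R) :=
  [set z | le_on I z.1 z.2 \/ le_on I z.2 z.1].

Lemma measurable_concordant I : measurable (concordant I).
Proof.
have measurable_le (f g : d.-tuple R * d.-tuple R -> d.-tuple R) :
    measurable_fun setT f -> measurable_fun setT g ->
    measurable [set z | le_on I (f z) (g z)].
  move=> mf mg; apply: measurable_forall_fin => j.
  have [jI|jI] := boolP (j \in I); last first.
    rewrite [X in measurable X](_ : _ = setT)//.
    by apply/seteqP; split=> // z _ /=.
  rewrite [X in measurable X](_ : _ =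
      setT `&` [set z | tnth (f z) j <= tnth (g z) j]).
    have /measurable_fun_tnthP/(_ j) mfj := mf.
    have /measurable_fun_tnthP/(_ j) mgj := mg.
    exact: measurable_fun_le.
  by rewrite setTI; apply/seteqP; split=> z /=; [exact|move=> fg _].
by apply: measurableU; apply: measurable_le.
Qed.

Lemma one_sided_antithetic I S x : one_sided I S ->
  exists2 z, z = x \/ z = 1 - x &
    forall j, j \in I -> tnth (antithetic S x) j = z.
Proof.
move=> /orP[|] /fintype.subsetP IS.
  exists x; first by left.
  by move=> j /IS jS; rewrite tnth_mktuple jS.
exists (1 - x); first by right.
by move=> j /IS; rewrite inE tnth_mktuple => /negbTE ->.
Qed.

Lemma two_sided_antithetic I S x : ~~ one_sided I S ->
  exists i j, [/\ i \in I, j \in I, tnth (antithetic S x) i = x &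
    tnth (antithetic S x) j = 1 - x].
Proof.
rewrite negb_or => /andP[/fintype.subsetPn[j jI jS] /fintype.subsetPn[i iI]].
rewrite inE negbK => iS; exists i, j.
by rewrite !tnth_mktuple iS (negbTE jS).
Qed.

Lemma antithetic_coordP S x j :
  tnth (antithetic S x) j = x \/ tnth (antithetic S x) j = 1 - x.
Proof. by rewrite tnth_mktuple; case: ifP; [left|right]. Qed.

Lemma concordant_one_one I S S' x y : one_sided I S -> one_sided I S' ->
  concordant I (antithetic S x, antithetic S' y).
Proof.
move=> /(@one_sided_antithetic _ _ x)[z _ zE].
move=> /(@one_sided_antithetic _ _ y)[z' _ zE'].
by have [zz'|/ltW zz'] := leP z z'; [left|right] => j jI /=; rewrite zE// zE'.
Qed.

(** On [I] the first vector is constant, equal to [x] or [1 - x], while the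
    second takes both values [y] and [1 - y]. Concordance means that the
    constant lies on one side of both, that is [`|x - 1/2| >= `|y - 1/2|],
    which does not depend on which of the two constants it is. *)
Lemma concordant_one_two I S S' x y : one_sided I S -> ~~ one_sided I S' ->
  concordant I (antithetic S x, antithetic S' y) <->
  (x <= y /\ x <= 1 - y) \/ (y <= x /\ 1 - y <= x).
Proof.
move=> /(@one_sided_antithetic _ _ x)[z zx zE].
move=> /(@two_sided_antithetic _ _ y)[i [j [iI jI iE jE]]].
split=> [[h|h]|h].
- have := h i iI; have := h j jI; rewrite /= !zE// iE jE.
  by case: zx => ->; lra.
- have := h i iI; have := h j jI; rewrite /= !zE// iE jE.
  by case: zx => ->; lra.
- have [zz|zz] : z <= y /\ z <= 1 - y \/ y <= z /\ 1 - y <= z.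
    by case: zx => ->; lra.
  + left=> k kI /=; rewrite zE//.
    by case: (antithetic_coordP S' y k) => ->; lra.
  + right=> k kI /=; rewrite zE//.
    by case: (antithetic_coordP S' y k) => ->; lra.
Qed.

Lemma concordantC I u v : concordant I (u, v) <-> concordant I (v, u).
Proof. by rewrite /concordant /=; tauto. Qed.

(** An inequality between the two vectors on [I] compares the largest value of
    each, and also the smallest. As both ranges are symmetric about 1/2, the
    first comparison orders the distances of [x] and [y] to 1/2 one way and
    the second the other way. *)
Lemma concordant_two_two I S S' x y : ~~ one_sided I S -> ~~ one_sided I S' ->
  concordant I (antithetic S x, antithetic S' y) -> diagonals (x, y).
Proof.
move=> /(@two_sided_antithetic _ _ x)[i [j [iI jI iE jE]]].
move=> /(@two_sided_antithetic _ _ y)[i' [j' [iI' jI' iE' jE']]].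
rewrite /diagonals /=.
move=> [] h; move: (h i iI) (h j jI) (h i' iI') (h j' jI') => /=;
  rewrite iE jE iE' jE'.
all: case: (antithetic_coordP S' y i) => ->;
  case: (antithetic_coordP S' y j) => ->;
  case: (antithetic_coordP S x i') => ->;
  case: (antithetic_coordP S x j') => ->;
  by move=> *; first [left; lra | right; lra].
Qed.

Local Notation unif2 := (unif \x unif)%E.

Definition concordance_set I S S' : set (R * R) :=
  [set z | concordant I (antithetic S z.1, antithetic S' z.2)].

Lemma measurable_concordance_set I S S' :
  @measurable _ (measurableTypeR R * measurableTypeR R)%type
    (concordance_set I S S').
Proof.
rewrite -[X in measurable X]setTI.
by apply: measurable_antithetic_pair => //; exact: measurable_concordant.
Qed.

(** If [I] is one-sided for exactly one of the two sets, the two concordance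
    sets are [`|x - 1/2| >= `|y - 1/2|] and its converse: they cover the plane
    and meet only on the diagonals. *)
Lemma concordance_sum I S S' :
  (unif2 (concordance_set I S S') + unif2 (concordance_set I S' S) =
   ((one_sided I S)%:R + (one_sided I S')%:R)%:E)%E.
Proof.
have mE := measurable_concordance_set I.
have unif2T : unif2 setT = 1%E by exact: probability_setT.
wlog SS' : S S' / one_sided I S' -> one_sided I S.
  move=> h; have [S1|S2] := boolP (one_sided I S).
    by have := h S S'; rewrite S1; apply.
  rewrite addeC (h S' S); last by rewrite (negbTE S2).
  by rewrite (negbTE S2) addrC.
case: (boolP (one_sided I S')) SS' => [S'1 /(_ isT) S1|S'2 _].
  have ET X X' : one_sided I X -> one_sided I X' ->
      concordance_set I X X' = setT.
    by move=> X1 X'1; apply/seteqP; split=> // z _; exact: concordant_one_one.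
  by rewrite !ET// unif2T S1.
have [S1|S2] := boolP (one_sided I S); last first.
  have E0 X X' : ~~ one_sided I X -> ~~ one_sided I X' ->
      unif2 (concordance_set I X X') = 0%E.
    move=> X2 X'2; apply: (subset_measure0 _ _ _ diagonals_null).
    - exact: mE.
    - exact: measurable_diagonals.
    - by move=> z; exact: concordant_two_two.
  by rewrite !E0// adde0 addr0.
rewrite (measure_setD_null (mE S S') measurable_diagonals diagonals_null).
rewrite (measure_setD_null (mE S' S) measurable_diagonals diagonals_null).
rewrite -measureU; last 3 first.
- exact: measurableD (mE _ _) measurable_diagonals.
- exact: measurableD (mE _ _) measurable_diagonals.
- apply/seteqP; split=> // -[x y] [[+ nd] [+ _]].
  rewrite /concordance_set /= => /(concordant_one_two _ _ S1 S'2) h.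
  move=> /concordantC/(concordant_one_two _ _ S1 S'2) h'.
  by apply: nd; rewrite /diagonals /=; lra.
rewrite -setDUl (_ : _ `|` _ = setT) -?setTD.
  rewrite setTD; transitivity (1 - unif2 diagonals)%E.
    by apply: probability_setC; exact: measurable_diagonals.
  by rewrite diagonals_null sube0 addr0.
apply/seteqP; split=> // -[x y] _.
have : (x <= y /\ x <= 1 - y \/ y <= x /\ 1 - y <= x) \/
       (y <= x /\ y <= 1 - x \/ x <= y /\ 1 - x <= y) by lra.
move=> [|] h; [left|right].
  by apply/(concordant_one_two x y S1 S'2).
by apply/concordantC/(concordant_one_two y x S1 S'2).
Qed.

End Concordance.

Section Kappa.
Variables (R : realType) (d : nat) (K : finType) (J : K -> {set 'I_d}).
Variables (w : K -> R) (C : d.-tuple R -> R).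
Hypotheses (w0 : forall k, 0 <= w k) (w1 : \sum_k w k = 1).
Hypothesis CE : forall u, unit_cube u ->
  C u = \sum_k w k * antithetic_copula (J k) u.

(** Concordance probabilities of independent copies are linear in the weights:
    averaging the joint law over [(k, l)] and [(l, k)] replaces the concordance
    probability of a pair by half of a sum of indicators, by [concordance_sum],
    and the weights add up to 1. *)
Lemma concordance_probability (disp : measure_display) (T : measurableType disp)
    (P : probability T R) (U V : {RV P >-> d.-tuple R}) (I : {set 'I_d}) :
    follows U C -> follows V C -> independent U V ->
  P [set t | concordant I (U t, V t)] =
  (\sum_k w k * (one_sided I (J k))%:R)%:E.
Proof.
move=> fU fV UV.
rewrite (joint_law w0 CE fU fV UV (measurable_concordant I)).
have [e eE] : exists e : K -> K -> R, forall k l,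
    (uniform_prob (@ltr01 R) \x uniform_prob (@ltr01 R))%E
      (concordance_set I (J k) (J l)) = (e k l)%:E.
  exists (fun k l => fine ((uniform_prob (@ltr01 R) \x
    uniform_prob (@ltr01 R))%E (concordance_set I (J k) (J l)))) => k l.
  rewrite fineK// ge0_fin_numE ?measure_ge0//.
  apply: (@le_lt_trans _ _ 1%E); last exact: ltry.
  by apply: probability_le1; exact: measurable_concordance_set.
pose a k : R := (one_sided I (J k))%:R.
have eD k l : e k l + e l k = a k + a l.
  have eSum := concordance_sum R I (J k) (J l).
  by rewrite !eE -EFinD in eSum; case: eSum.
transitivity (\sum_k \sum_l w k * w l * e k l)%:E.
  rewrite -sumEFin; apply: eq_bigr => k _; rewrite -sumEFin.
  by apply: eq_bigr => l _; rewrite [in RHS]EFinM -eE.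
(* Twice the sum, with the two indices exchanged in the second copy. *)
congr EFin; apply: (@mulfI _ 2%:R); first by rewrite pnatr_eq0.
rewrite !mulr_natl mulr2n [X in _ + X]exchange_big -big_split /=.
transitivity (\sum_k (\sum_l w k * w l * a k + \sum_l w k * w l * a l)).
  apply: eq_bigr => k _; rewrite -!big_split; apply: eq_bigr => l _ /=.
  by rewrite [w l * w k]mulrC -!mulrDr eD.
rewrite big_split /= [X in _ + X]exchange_big mulr2n; congr (_ + _).
all: apply: eq_bigr => k _.
  by rewrite -mulr_suml -mulr_sumr w1 mulr1.
by rewrite -mulr_suml -mulr_suml w1 mul1r.
Qed.

End Kappa.

(** * Independent copies and the equivalence *)

(** Equiconcordance quantifies over independent pairs, and would be void for a
    copula without one; the square of any space that carries the copula has
    such a pair. *)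
Section IndependentCopy.
Variables (R : realType) (d : nat) (C : d.-tuple R -> R).
Variables (disp : measure_display) (T : measurableType disp).
Variables (P : probability T R) (U : {RV P >-> d.-tuple R}).
Hypothesis fU : follows U C.

Let P2 : probability (T * T)%type R := (P \x P)%E.

Lemma independent_copy : exists V W : {RV P2 >-> d.-tuple R},
  [/\ follows V C, follows W C & independent V W].
Proof.
have mV : measurable_fun setT (U \o @fst T T) by exact: measurableT_comp.
have mW : measurable_fun setT (U \o @snd T T) by exact: measurableT_comp.
exists (mfun_Sub (mem_set mV)), (mfun_Sub (mem_set mW)).
have mU A : measurable A -> measurable (U @^-1` A).
  by move=> mA; rewrite -[X in measurable X]setTI; exact: measurable_funP.
have P2E A B : measurable A -> measurable B ->
    P2 ([set t | A (U t.1)] `&` [set t | B (U t.2)]) =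
    (P (U @^-1` A) * P (U @^-1` B))%E.
  by move=> mA mB; rewrite -product_measure1E//; exact: mU.
have [margU cdfU] := fU.
have PT : P (U @^-1` setT) = 1%E by rewrite preimage_setT probability_setT.
have P2E1 A : measurable A -> P2 [set t | A (U t.1)] = P (U @^-1` A).
  by move=> mA; have := P2E A setT mA measurableT; rewrite setIT PT mule1.
have P2E2 A : measurable A -> P2 [set t | A (U t.2)] = P (U @^-1` A).
  by move=> mA; have := P2E setT A measurableT mA; rewrite setTI PT mul1e.
split.
- split=> [j A mA|u u01].
    rewrite [LHS](P2E1 [set x | A (tnth x j)])//; first exact: margU.
    exact: measurable_coord.
  by rewrite [LHS](P2E1 (box u))//; [exact: cdfU|exact: measurable_box].
- split=> [j A mA|u u01].
    rewrite [LHS](P2E2 [set x | A (tnth x j)])//; first exact: margU.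
    exact: measurable_coord.
  by rewrite [LHS](P2E2 (box u))//; [exact: cdfU|exact: measurable_box].
- move=> A B mA mB; rewrite [LHS]P2E//.
  by congr (_ * _)%E; apply/esym; [exact: P2E1|exact: P2E2].
Qed.
End IndependentCopy.

Theorem proposition7 (R : realType) (d : nat) (hd : (2 <= d)%N)
    (w : 'I_(2 ^ d.-1) -> R) (C : d.-tuple R -> R)
    (hC : extremal_mixture_copula w C) :
  [<-> exchangeable C;
       equiconcordant C;
       forall k l : 'I_(2 ^ d.-1), eta k = eta l -> w k = w l].
Proof.
case: d hd w C hC => // d _ w C [[disp [T [P [U fU]]]] w0 w1 CE].
have kappaE disp' (T' : measurableType disp') (P' : probability T' R)
    (V W : {RV P' >-> d.+1.-tuple R}) (I : {set 'I_d.+1}) :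
    follows V C -> follows W C -> independent V W -> (2 <= #|I|)%N ->
  kappa V W I = (one_sided_weight w I)%:E.
  move=> fV fW VW I2; rewrite /kappa I2.
  exact: (concordance_probability w0 w1 CE).
tfae.
- move=> exC disp' T' P' V W fV fW VW I I' _ _ II'.
  have [I2|I2] := leqP 2 #|I|; last by rewrite /kappa -II' leqNgt I2.
  rewrite !kappaE -?II'//; congr EFin.
  apply: (one_sided_weight_exchangeable CE exC) => //.
  by rewrite -card_gt0; exact: leq_trans I2.
- move=> eqC; have [V [W [fV fW VW]]] := independent_copy fU.
  apply: weights_eta_of_one_sided => I I' I2 Ie II'.
  apply: EFin_inj; rewrite -(kappaE _ _ _ _ _ _ fV fW VW)//.
  rewrite -(kappaE _ _ _ _ _ _ fV fW VW) -?II'//.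
  by apply: (eqC _ _ _ _ _ fV fW VW) => //; rewrite -II'.
- exact: exchangeable_of_weights_eta.
Qed.
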